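(* Every nontrivial quasi-diagram is an iterated expansion of a chord diagram, and every nontrivial maximal quasi-diagram is an iterated expansion of a maximal chord diagram.
   Context: Permutations are composed from right to left and $\zeta_n=(1\,2\cdots n)\in\mathfrak S_n$. A quasi-diagram is a permutation $\alpha\in\mathfrak S_n$ ($n\ge1$) with $\alpha^2=\mathrm{id}$; $\mathfrak D_n\subset\mathfrak S_n$ is the set of quasi-diagrams. The identity $\mathrm{id}\in\mathfrak D_n$ is the trivial quasi-diagram; nontrivial means different from the identity. A chord diagram is a quasi-diagram without fixed points. A quasi-diagram $\alpha\in\mathfrak D_n$ is maximal if $\zeta_n\alpha$ has only one orbit on $\{1,\dots,n\}$. Identify $\mathfrak S_n$ with the subgroup of $\mathfrak S_{n+1}$ fixing $n+1$. For $\alpha\in\mathfrak D_n$ and $1\le i\le n+1$, the $i$-expansion of $\alpha$ is $\iota_i(\alpha)=\vartheta_{i,n+1}\,\alpha\,(\vartheta_{i,n+1})^{-1}\in\mathfrak D_{n+1}$, where $\vartheta_{i,n+1}=(i,i+1,\dots,n,n+1)\in\mathfrak S_{n+1}$ is the cycle (the identity if $i=n+1$). A quasi-diagram $\alpha'\in\mathfrak D_{n+r}$ is an iterated expansion of $\alpha\in\mathfrak D_n$ if $\alpha'=\iota_{i_r}\cdots\iota_{i_2}\iota_{i_1}(\alpha)$ for some $i_1,\dots,i_r$ with $1\le i_s\le n+s$; here $r\ge0$, and $r=0$ means $\alpha'=\alpha$. *)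

(* Defs.v *)
From mathcomp Require Import all_boot all_fingroup.

Set Implicit Arguments.
Unset Strict Implicit.
Unset Printing Implicit Defensive.

Local Open Scope group_scope.

(* The points 1, ..., n are represented by the ordinals 0, ..., n-1 of 'I_n.
   MathComp composes permutations from left to right, (s * t) x = t (s x), so
   the right-to-left product "s t" is written t * s below. *)

Definition zeta (n : nat) : 'S_n := perm (@ordS_inj n).

Definition quasi_diagram (n : nat) (alpha : 'S_n) : Prop :=
  (0 < n)%N /\ alpha ^+ 2 = 1.

Definition chord_diagram (n : nat) (alpha : 'S_n) : Prop :=
  quasi_diagram alpha /\ forall x : 'I_n, alpha x <> x.

Definition maximal (n : nat) (alpha : 'S_n) : Prop :=
  #|porbits (alpha * zeta n)| = 1%N.

Definition theta_fun (n : nat) (i j : 'I_n.+1) : 'I_n.+1 :=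
  if (j < i)%N then j else if j == ord_max then i else ordS j.

Lemma theta_fun_inj (n : nat) (i : 'I_n.+1) : injective (theta_fun i).
Proof.
suff E j : theta_fun i j = lift_perm ord_max i 1 j.
  by move=> j k; rewrite !E; apply: perm_inj.
rewrite /theta_fun; case: (unliftP ord_max j) => [k|] ->; last first.
  by rewrite lift_perm_id eqxx ltnNge -ltnS ltn_ord.
rewrite lift_perm_lift perm1 eq_sym (negPf (neq_lift _ _)); apply: val_inj.
have -> : (lift ord_max k : nat) = k by rewrite /= /bump leqNgt ltn_ord.
rewrite [RHS]/= [in RHS]/bump; case: (ltnP k i) => _ /=.
  by rewrite /bump leqNgt ltn_ord.
by rewrite /bump leqNgt ltn_ord add0n modn_small // ltnS ltn_ord.
Qed.

(* The cycle (i, i+1, ..., n, n+1) of 'S_n.+1. *)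
Definition theta (n : nat) (i : 'I_n.+1) : 'S_n.+1 := perm (@theta_fun_inj n i).

(* 'S_n as the subgroup of 'S_n.+1 fixing the last point. *)
Definition embed (n : nat) (alpha : 'S_n) : 'S_n.+1 :=
  lift_perm ord_max ord_max alpha.

Definition expansion (n : nat) (i : 'I_n.+1) (alpha : 'S_n) : 'S_n.+1 :=
  (theta i)^-1 * embed alpha * theta i.

Inductive iterated_expansion (n : nat) (alpha : 'S_n) :
    forall m : nat, 'S_m -> Prop :=
| IterExp0 : iterated_expansion alpha alpha
| IterExpS (m : nat) (beta : 'S_m) (i : 'I_m.+1) :
    iterated_expansion alpha beta ->
    iterated_expansion alpha (expansion i beta).

(* Main.v *)
Require Import Defs.
From mathcomp Require Import all_boot all_fingroup zify.

(** Expanding at [i] inserts a new fixed point in position [i]: the cycle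
    [theta i] is the order-preserving relabelling of the old points as the
    complement of [i], so [expansion i] is [lift_perm i i] (lemma
    [expansionE]).  Hence any fixed point of an
    involution can be removed, and an expansion recovers the involution from
    the result.  Removing fixed points one by one terminates, and a nontrivial
    involution remains nontrivial, so the process stops at a fixed-point free
    involution on a nonempty set, i.e. a chord diagram.

    Maximality survives each removal.  If [alpha] is obtained from [beta] by
    inserting the fixed point [i], then the cycles of [beta * zeta n] are those
    of [alpha * zeta n.+1] with the point [i] skipped (lemma
    [lift_perm_zeta_skip]), and skipping a point cannot disconnect a cycle
    (lemma [porbit_skip]). *)

Set Implicit Arguments.
Unset Strict Implicit.
Unset Printing Implicit Defensive.

Local Open Scope group_scope.

Lemma modn_succ n j : (j <= n)%N -> j.+1 %% n.+1 = if j == n then 0%N else j.+1.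
Proof.
by move=> le_jn; case: eqP => [->|ne]; [rewrite modnn | rewrite modn_small //; lia].
Qed.

Lemma theta_lift n (i : 'I_n.+1) : theta i = lift_perm ord_max i 1.
Proof.
apply/permP=> j; rewrite permE /theta_fun.
case: (unliftP ord_max j) => [k|] ->; last first.
  by rewrite lift_perm_id eqxx ltnNge -ltnS ltn_ord.
rewrite lift_perm_lift perm1 eq_sym (negPf (neq_lift _ _)); apply: val_inj.
case: k => k /= lt_kn; rewrite (fun_if val) /= modn_succ /bump; last lia.
by do ![case: ifP => ?]; lia.
Qed.

Lemma expansionE n (i : 'I_n.+1) (alpha : 'S_n) :
  expansion i alpha = lift_perm i i alpha.
Proof.
by rewrite /expansion theta_lift lift_permV !lift_permM invg1 mul1g mulg1.
Qed.

Lemma lift_perm_inj n (i j : 'I_n.+1) : injective (lift_perm i j).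
Proof.
move=> s t eq_st; apply/permP=> k; apply: (@lift_inj _ j).
by rewrite -!(lift_perm_lift i) eq_st.
Qed.

(** A permutation that fixes [i] permutes the other points, so it is an
    insertion of [i]; the default value in [f] is never reached. *)
Lemma fixed_point_lift_perm n (s : 'S_n.+1) (i : 'I_n.+1) :
  s i = i -> exists t : 'S_n, s = lift_perm i i t.
Proof.
move=> si.
pose f j := odflt j (unlift i (s (lift i j))).
have fE j : lift i (f j) = s (lift i j).
  rewrite /f; case: unliftP => [k -> //|sj].
  have /perm_inj e : s (lift i j) = s i by rewrite si.
  by have := neq_lift i j; rewrite e eqxx.
have f_inj : injective f.
  by move=> j k /(congr1 (lift i)); rewrite !fE => /perm_inj/lift_inj.
exists (perm f_inj); apply/permP=> x.
case: (unliftP i x) => [j|] ->; last by rewrite lift_perm_id.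
by rewrite lift_perm_lift permE fE.
Qed.

(** The hypothesis says that [t] is the first-return map of [s] on the
    complement of [i]; so an [s]-trajectory between two points other than [i]
    becomes a [t]-trajectory once its visits to [i] are deleted. *)
Lemma porbit_skip n (i : 'I_n.+1) (s : 'S_n.+1) (t : 'S_n) :
    (forall j, lift i (t j) =
       if s (lift i j) == i then s i else s (lift i j)) ->
  forall x y, lift i y \in porbit s (lift i x) -> y \in porbit t x.
Proof.
move=> st x y /porbitP[k]; elim/ltn_ind: k x => k IHk x.
case: k IHk => [_|k IHk]; first by rewrite perm1 => /lift_inj->; apply: porbit_id.
rewrite expgS permM; have:= st x; case: eqP => [-> tx|_ <- eq_y]; last first.
  by rewrite -(porbit_perm t 1); apply: IHk eq_y.
(* The visit to [i] takes one more step, and the return point is [t x]. *)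
case: k IHk => [_|k IHk].
  by rewrite perm1 => /eqP; rewrite eq_sym (negPf (neq_lift _ _)).
rewrite expgS permM -tx => eq_y; rewrite -(porbit_perm t 1).
by apply: IHk eq_y.
Qed.

Lemma card_porbits1P (T : finType) (s : {perm T}) (x : T) :
  (#|porbits s| = 1%N) <-> (forall y, y \in porbit s x).
Proof.
split=> [/eqP/cards1P[A defA] y|sx].
  have orbA z : porbit s z = A by apply/set1P; rewrite -defA imset_f.
  by rewrite orbA -(orbA y) porbit_id.
rewrite -(cards1 (porbit s x)); congr #|pred_of_set _|; apply/setP=> A.
rewrite in_set1; apply/imsetP/eqP => [[y _ ->]|->]; last by exists x.
by apply/eqP; rewrite eq_porbit_mem.
Qed.

(** Deleting [i] from the cyclic sequence of all points leaves the cyclic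
    sequence of the others: the predecessor of [i] is now followed by the
    successor of [i]. *)
Lemma zeta_skip n (i : 'I_n.+1) (k : 'I_n) :
  lift i (zeta n k) =
    if zeta n.+1 (lift i k) == i then zeta n.+1 i else zeta n.+1 (lift i k).
Proof.
rewrite !permE; case: n i k => [i []//|n] i k.
apply: val_inj; rewrite (fun_if val) -val_eqE /=.
case: i k => [i /= lt_in] [k /= lt_kn]; rewrite !modn_succ /bump; try lia.
by case: (k =P n) => ?; case: (_ + k =P n.+1) => ?; do ![case: ifP => ?]; lia.
Qed.

Lemma lift_perm_zeta_skip n (i : 'I_n.+1) (beta : 'S_n) (j : 'I_n) :
  let s := lift_perm i i beta * zeta n.+1 in
  lift i ((beta * zeta n) j) =
    if s (lift i j) == i then s i else s (lift i j).
Proof. by rewrite /= !permM lift_perm_lift lift_perm_id zeta_skip. Qed.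

Lemma maximal_lift_perm n (i : 'I_n.+1) (beta : 'S_n) :
  (0 < n)%N -> maximal (lift_perm i i beta) -> maximal beta.
Proof.
case: n i beta => // n i beta _ max_i; apply/(card_porbits1P _ ord0) => y.
apply: (porbit_skip (lift_perm_zeta_skip i beta)).
exact: (card_porbits1P _ _).1 max_i _.
Qed.

(** [beta <> 1] is what keeps the removal going: it forces [0 < n], so the
    process never reaches the empty set, which carries no chord diagram. *)
Lemma quasi_diagram_lift_perm n (i : 'I_n.+1) (beta : 'S_n) :
    quasi_diagram (lift_perm i i beta) -> lift_perm i i beta <> 1 ->
  quasi_diagram beta /\ beta <> 1.
Proof.
move=> [_ sq1] ne1.
have bn1 : beta <> 1 by move=> b1; apply: ne1; rewrite b1 lift_perm1.
split=> //; split.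
  by case: n i beta {sq1 ne1} bn1 => // i beta []; apply/permP; case.
apply: (@lift_perm_inj _ i i).
by rewrite lift_perm1 -sq1 !expgS expg0 !mulg1 lift_permM.
Qed.

(** Both halves of the theorem are instances, with [P] trivial or [maximal]:
    all that matters is that [P] survives the removal of a fixed point. *)
Lemma chord_diagram_expansion (P : forall n, 'S_n -> Prop) :
    (forall n (i : 'I_n.+1) (beta : 'S_n),
       (0 < n)%N -> P n.+1 (lift_perm i i beta) -> P n beta) ->
  forall n (alpha : 'S_n), quasi_diagram alpha -> P n alpha -> alpha <> 1 ->
  exists (m : nat) (beta : 'S_m),
    [/\ chord_diagram beta, P m beta & iterated_expansion beta alpha].
Proof.
move=> Pdown; elim=> [|n IHn] alpha qd Pa ne1; first by case: qd.
have [/existsP[i /eqP fix_i]|nofix] := boolP [exists i, alpha i == i]; last first.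
  exists n.+1, alpha; split=> //; last exact: IterExp0.
  by split=> // x /eqP fix_x; case/existsP: nofix; exists x.
have [beta defa] := fixed_point_lift_perm fix_i; rewrite {}defa in qd Pa ne1 *.
have [qb nb1] := quasi_diagram_lift_perm qd ne1.
have [m [gamma [cg Pg ig]]] := IHn beta qb (Pdown _ _ _ qb.1 Pa) nb1.
by exists m, gamma; split=> //; rewrite -expansionE; apply: IterExpS.
Qed.

Theorem proposition1p3 :
  (forall (n : nat) (alpha : 'S_n),
     quasi_diagram alpha -> alpha <> 1%g ->
     exists (m : nat) (beta : 'S_m),
       chord_diagram beta /\ iterated_expansion beta alpha) /\
  (forall (n : nat) (alpha : 'S_n),
     quasi_diagram alpha -> maximal alpha -> alpha <> 1%g ->
     exists (m : nat) (beta : 'S_m),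
       [/\ chord_diagram beta, maximal beta & iterated_expansion beta alpha]).
Proof.
split=> [n alpha qd ne1|]; last first.
  exact: (chord_diagram_expansion maximal_lift_perm).
have [//|m [beta [cb _ ib]]] :=
  @chord_diagram_expansion (fun _ _ => True) _ n alpha qd I ne1.
by exists m, beta.
Qed.
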